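(* Let $(E,B,P)$ be a probability space, let $a<b$ be real numbers, and let $p\ge 1$ be an integer. Suppose $f:[a,b]\to L(E,B,P)$ is of the form $f(t,\omega)=\sum_{k=1}^{p}C_k(\omega)\cdot\varphi_k(t)$, where $C_k\in L(E,B,P)$ and $\varphi_k:[a,b]\to\mathbb{R}$ is Kurzweil-Henstock integrable on $[a,b]$ for each $k=1,\dots,p$. Then $f$ is Kurzweil-Henstock integrable in probability on $[a,b]$ and $$(KH)\int_a^b f(t,\omega)\,dt=\sum_{k=1}^{p}C_k(\omega)\cdot (KH)\int_a^b\varphi_k(t)\,dt,$$ where the equality is between random variables, up to $P$-a.e. equality.
   Context: $(E,B,P)$ is a probability space ($E$ a nonempty set, $B$ a $\sigma$-field of subsets of $E$, $P$ a countably additive probability on $B$). $L(E,B,P)$ denotes the set of all real random variables defined on $E$ that are a.e. finite (pointwise expressions in such random variables are understood outside a $P$-null set). For $f:[a,b]\to L(E,B,P)$ write $f(t,\omega)$ for the value of the random variable $f(t)$ at $\omega$. For a division $d: a=x_0<x_1<\dots<x_n=b$ with tags $\xi_i\in[x_i,x_{i+1}]$, $i=0,\dots,n-1$, put $S(f;d,\xi_i)(\omega)=\sum_{i=0}^{n-1}f(\xi_i,\omega)(x_{i+1}-x_i)$. A function $f:[a,b]\to L(E,B,P)$ is Kurzweil-Henstock integrable in probability on $[a,b]$ if there exists $I\in L(E,B,P)$ such that for all $\varepsilon>0$ and $\eta>0$ there exists $\delta_{\varepsilon,\eta}:[a,b]\to(0,\infty)$ such that for every division $d:a=x_0<\dots<x_n=b$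 and all $\xi_i\in[x_i,x_{i+1}]$ with $x_{i+1}-x_i<\delta_{\varepsilon,\eta}(\xi_i)$, $i=0,\dots,n-1$, one has $$P(\{\omega\in E : |S(f;d,\xi_i)(\omega)-I(\omega)|\ge\varepsilon\})<\eta.$$ Such an $I$ is unique up to $P$-a.e. equality and is denoted $I(\omega)=(KH)\int_a^b f(t,\omega)\,dt$. A function $\varphi:[a,b]\to\mathbb{R}$ is Kurzweil-Henstock integrable on $[a,b]$ if there exists $J\in\mathbb{R}$ such that for every $\varepsilon>0$ there exists $\delta_\varepsilon:[a,b]\to(0,\infty)$ such that for every division $d:a=x_0<\dots<x_n=b$ and all $\xi_i\in[x_i,x_{i+1}]$ with $x_{i+1}-x_i<\delta_\varepsilon(\xi_i)$, $i=0,\dots,n-1$, one has $|J-\sum_{i=0}^{n-1}\varphi(\xi_i)(x_{i+1}-x_i)|<\varepsilon$. One writes $J=(KH)\int_a^b\varphi(t)\,dt$. *)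

(* Defs.v *)
From mathcomp Require Import all_boot all_order all_algebra.
From mathcomp Require Import all_classical all_reals all_analysis.
From mathcomp Require Import measurable_realfun.

Set Implicit Arguments.
Unset Strict Implicit.
Unset Printing Implicit Defensive.

Import Order.TTheory GRing.Theory Num.Theory.
Local Open Scope classical_set_scope.
Local Open Scope ring_scope.

Section KurzweilHenstock.
Variable R : realType.
Implicit Types (a b : R) (s : seq R) (xi : nat -> R) (delta : R -> R).

(* The points of a division of [a, b] are x_i = nth b (a :: s) i for
   0 <= i <= size s; in particular x_0 = a and x_(size s) = b.  A function on
   [a, b] (integrand, gauge) is represented by a total function on R of which
   only the values on [a, b] are used, and tags xi_i only matter for
   i < size s. *)
Definition tagged_division a b s xi : Prop :=
  itv_partition a b s /\
  forall i, (i < size s)%N ->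
    xi i \in `[nth b (a :: s) i, nth b (a :: s) i.+1].

Definition gauge_on a b delta : Prop :=
  forall t, t \in `[a, b] -> 0 < delta t.

Definition gauge_fine a b delta s xi : Prop :=
  forall i, (i < size s)%N ->
    nth b (a :: s) i.+1 - nth b (a :: s) i < delta (xi i).

Definition riemann_sum a b (phi : R -> R) s xi : R :=
  \sum_(i < size s) phi (xi i) * (nth b (a :: s) i.+1 - nth b (a :: s) i).

Definition is_KH_integral a b (phi : R -> R) (J : R) : Prop :=
  forall eps : R, 0 < eps ->
  exists2 delta, gauge_on a b delta &
    forall s xi, tagged_division a b s xi -> gauge_fine a b delta s xi ->
      `|J - riemann_sum a b phi s xi| < eps.

Definition KH_integrable a b (phi : R -> R) : Prop :=
  exists J, is_KH_integral a b phi J.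

Definition KH_integral a b (phi : R -> R) : R :=
  xget 0 [set J | is_KH_integral a b phi J].

Section InProbability.
Context {d : measure_display} {E : measurableType d} (P : probability E R).

(* The set L(E, B, P).  An a.e. finite random variable may be infinite on a
   null set, hence the values in \bar R; the conventions of \bar R for
   oo - oo and 0 * oo are only ever used on such a null set. *)
Definition ae_finite_rv : set (E -> \bar R) :=
  [set X : E -> \bar R | measurable_fun [set: E] X /\
           {ae P, forall w, X w \is a fin_num}].

Definition rv_riemann_sum a b (f : R -> E -> \bar R) s xi : E -> \bar R :=
  fun w => (\sum_(i < size s)
    f (xi i) w * (nth b (a :: s) i.+1 - nth b (a :: s) i)%:E)%E.

Definition is_KH_integral_prob a b (f : R -> E -> \bar R) (I : E -> \bar R) :
    Prop :=
  ae_finite_rv I /\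
  forall eps eta : R, 0 < eps -> 0 < eta ->
  exists2 delta, gauge_on a b delta &
    forall s xi, tagged_division a b s xi -> gauge_fine a b delta s xi ->
      (P [set w | eps%:E <= `|rv_riemann_sum a b f s xi w - I w|] < eta%:E)%E.

Definition KH_integrable_prob a b (f : R -> E -> \bar R) : Prop :=
  exists I, is_KH_integral_prob a b f I.

(* The integral is only determined up to P-a.e. equality: this is one chosen
   representative. *)
Definition KH_integral_prob a b (f : R -> E -> \bar R) : E -> \bar R :=
  xget (cst 0%E) [set I | is_KH_integral_prob a b f I].

End InProbability.
End KurzweilHenstock.

(* Main.v *)
Require Import Defs.
From mathcomp Require Import all_boot all_order all_algebra.
From mathcomp Require Import all_classical all_reals all_analysis.
From mathcomp Require Import measurable_realfun.
From mathcomp Require Import lra.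

Set Implicit Arguments.
Unset Strict Implicit.
Unset Printing Implicit Defensive.

Import Order.TTheory GRing.Theory Num.Theory.

Local Open Scope classical_set_scope.
Local Open Scope ring_scope.

(** For fixed w, the Riemann sum of [f] differs from the sum of the [C k w * J k] by at most G(w)
    times the largest error of the sums of the [phi k], where G is the sum of the |C_k|. As G is
    a.e. finite, [ae_finite_rv_tail] gives M with P(G >= M) < eta. A gauge with all errors below eps
    / M then forces G >= M almost everywhere that the error of [f] reaches eps. So the linear
    combination is an integral in probability ([is_KH_integral_prob_linear]). Since
    [KH_integral_prob] is only a chosen representative, the a.e. equality comes from uniqueness
    ([is_KH_integral_prob_unique]), which rests on the existence of fine divisions
    ([exists_gauge_fine]). *)

Lemma tagged_division_rcons (R : realType) (a x y t : R) (s : seq R)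
    (xi delta : R -> R) (tau : nat -> R) :
  tagged_division a x s tau -> gauge_fine a x delta s tau ->
  x < y -> t \in `[x, y] -> y - x < delta t ->
  exists s' tau', tagged_division a y s' tau' /\ gauge_fine a y delta s' tau'.
Proof.
move=> [[ps /eqP ls] tags] fine_s xy txy yx.
pose tau' i := if (i < size s)%N then tau i else t.
(* The default of [nth] passes from [x] to [y], harmlessly: these indices stay inside [a :: s]. *)
have old i : (i <= size s)%N -> nth y (a :: rcons s y) i = nth x (a :: s) i.
  move=> i_le; rewrite -rcons_cons nth_rcons /= ltnS i_le.
  by apply: set_nth_default; rewrite /= ltnS.
have old_last : nth x (a :: s) (size s) = x by rewrite -last_nth.
have new : nth y (a :: rcons s y) (size s).+1 = y.
  by rewrite /= nth_rcons ltnn eqxx.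
exists (rcons s y), tau'; split; first split.
- by split; rewrite ?rcons_path ?ps ?ls ?last_rcons.
- move=> i; rewrite size_rcons ltnS leq_eqVlt => /orP[/eqP->|i_lt].
    by rewrite new old// old_last /tau' ltnn.
  by rewrite !old ?(ltnW i_lt)// /tau' i_lt; exact: tags.
- move=> i; rewrite size_rcons ltnS leq_eqVlt => /orP[/eqP->|i_lt].
    by rewrite new old// old_last /tau' ltnn.
  by rewrite !old ?(ltnW i_lt)// /tau' i_lt; exact: fine_s.
Qed.

(* Cousin's lemma, by taking the supremum of the points up to which a fine
   division exists. *)
Lemma exists_gauge_fine (R : realType) (a b : R) (delta : R -> R) :
  a <= b -> gauge_on a b delta ->
  exists s tau, tagged_division a b s tau /\ gauge_fine a b delta s tau.
Proof.
move=> ab delta_gt0.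
pose A := [set x | [/\ a <= x, x <= b & exists s tau,
  tagged_division a x s tau /\ gauge_fine a x delta s tau]].
have Aa : A a.
  split=> //; exists [::], (fun=> a).
  by split; [split=> //; split=> //=; rewrite eqxx|].
have ubA : ubound A b by move=> x [].
have supA : has_sup A by split; [exists a|exists b].
set c := sup A.
have ac : a <= c by exact: sup_upper_bound.
have cb : c <= b by apply: ge_sup => //; exists a.
have dc : 0 < delta c by apply: delta_gt0; rewrite in_itv /= ac cb.
have dc2 : 0 < delta c / 2 by rewrite divr_gt0.
have [x Ax cx] := sup_adherent dc2 supA.
have xc : x <= c by exact: sup_upper_bound.
have [ax xb [s [tau [div_s fine_s]]]] := Ax.
(* Since [x] is within [delta c / 2] of [c], the cell from [x] to [y] tagged by [c] is shorter than
   [delta c]. *)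
pose y := Num.min b (c + delta c / 2).
have cy : c <= y by rewrite le_min cb/=; lra.
have yb : y <= b by rewrite ge_min lexx.
have yc : y <= c + delta c / 2 by rewrite ge_min lexx orbT.
have Ay : A y.
  have [xy|yx] := ltP x y; last first.
    by have -> : y = x by apply/le_anti; rewrite yx (le_trans xc cy).
  split=> //; first exact: le_trans ac cy.
  apply: (tagged_division_rcons delta div_s fine_s xy (t := c)).
    by rewrite in_itv /= xc cy.
  rewrite -/c in cx; lra.
(* As [y <= c < c + delta c / 2], the minimum defining [y] must be [b]. *)
have yc' : y <= c by exact: sup_upper_bound.
suff yE : y = b by move: Ay; rewrite yE => -[].
by move: yc'; rewrite /y; case: (leP b (c + delta c / 2)) => // ? ?; lra.
Qed.

Lemma tagged_division_mem (R : realType) (a b : R) s tau i :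
  tagged_division a b s tau -> (i < size s)%N -> tau i \in `[a, b].
Proof.
move=> [part tags] i_lt; have := tags i i_lt; rewrite !in_itv /= => /andP[lo hi].
apply/andP; split.
  by apply: le_trans lo; apply: itv_partition_nth_ge => //; exact: ltnW.
by apply: (le_trans hi); exact: (@itv_partition_nth_le _ _ a b s i.+1).
Qed.

(** * Almost everywhere finite random variables *)

Section AlmostEverywhere.
Context {R : realType} {d : measure_display} {E : measurableType d}.
Variable P : probability E R.
Implicit Types X Y : E -> \bar R.

(** The points of [A] outside [B] lie in a measurable null set, and adjoining it to [B] does not
    change the measure. *)
Lemma le_measure_ae (A B : set E) : measurable A -> measurable B ->
  {ae P, forall w, A w -> B w} -> (P A <= P B)%E.
Proof.
move=> mA mB [N [mN PN AB]].
rewrite -(measureU0 mB mN PN).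
apply: le_measure; rewrite ?inE//; first exact: measurableU.
move=> w Aw; have [Bw|nBw] := pselect (B w); [by left|right].
by apply: AB => /= /(_ Aw).
Qed.

Lemma measurable_abse_ge X (e : R) : measurable_fun [set: E] X ->
  measurable [set w | (e%:E <= `|X w|)%E].
Proof.
move=> mX; rewrite -[X in measurable X]setTI.
apply: (@emeasurable_fun_c_infty _ _ _ _ (fun w => `|X w|%E)) => //.
exact: measurableT_comp mX.
Qed.

(** The events |X| >= n + 1 decrease to an event on which [X] is infinite, hence null; continuity of
    [P] from above concludes. *)
Lemma ae_finite_rv_tail X (eta : R) : ae_finite_rv P X -> 0 < eta ->
  exists2 M : R, 0 < M & (P [set w | M%:E <= `|X w|] < eta%:E)%E.
Proof.
move=> [mX finX] eta_gt0.
pose F n := [set w | (n.+1%:R%:E <= `|X w|)%E].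
have mF n : measurable (F n) by exact: measurable_abse_ge.
have mcapF : measurable (\bigcap_n F n) by exact: bigcap_measurable.
have F0 : P (\bigcap_n F n) = 0%E.
  apply: measure_negligible => //; apply: negligibleS finX => w Fw /= Xw.
  have := Fw (Num.truncn `|fine (X w)|) I; rewrite /F /=.
  rewrite -(fineK Xw) /= lee_fin leNgt => /negP; apply.
  exact: truncnS_gt.
have : P \o F @ \oo --> P (\bigcap_n F n).
  apply: nonincreasing_cvg_mu => //.
    by rewrite (le_lt_trans (probability_le1 _ _)) ?ltry.
  move=> m n mn; apply/subsetPset => w; apply: le_trans.
  by rewrite lee_fin ler_nat.
rewrite F0 => /(_ [set x | (x < eta%:E)%E]) [].
  by apply: open_nbhs_nbhs; split; [exact: open_ereal_lt_ereal|rewrite /= lte_fin].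
move=> n _ /(_ n (leqnn n)) /= PF.
by exists n.+1%:R.
Qed.

Lemma ae_finite_rv_sum (n : nat) (X : 'I_n -> E -> \bar R) :
  (forall i, ae_finite_rv P (X i)) ->
  ae_finite_rv P (fun w => (\sum_(i < n) X i w)%E).
Proof.
move=> finX; split; first by apply: emeasurable_sum => i; case: (finX i).
have : {ae P, forall w, forall i, X i w \is a fin_num}.
  by apply: filter_forall => i; case: (finX i).
by apply: filterS => w Xw; apply/sum_fin_numP.
Qed.

Lemma ae_finite_rvZ X (c : R) : ae_finite_rv P X ->
  ae_finite_rv P (fun w => (X w * c%:E)%E).
Proof.
move=> [mX finX]; split; last by apply: filterS finX => w Xw; exact: fin_numM.
by under eq_fun do rewrite muleC; exact: measurable_funeM.
Qed.

Lemma ae_finite_rv_abse X : ae_finite_rv P X ->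
  ae_finite_rv P (fun w => `|X w|%E).
Proof.
move=> [mX finX]; split; first exact: measurableT_comp mX.
by apply: filterS finX => w; rewrite abse_fin_num.
Qed.

Lemma ae_finite_rvB X Y : ae_finite_rv P X -> ae_finite_rv P Y ->
  ae_finite_rv P (fun w => (X w - Y w)%E).
Proof.
move=> [mX finX] [mY finY]; split; first exact: emeasurable_funB.
by apply: filterS2 finX finY => w Xw Yw; rewrite fin_numB Xw.
Qed.

(** Letting eta tend to 0, each event |X - Y| >= 1 / (n + 1) is null, and so is their countable
    union. *)
Lemma ae_eq_probability X Y : ae_finite_rv P X -> ae_finite_rv P Y ->
  (forall eps eta : R, 0 < eps -> 0 < eta ->
    (P [set w | eps%:E <= `|X w - Y w|] < eta%:E)%E) ->
  {ae P, forall w, X w = Y w}.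
Proof.
move=> finX finY small; have [mXY _] := ae_finite_rvB finX finY.
pose F n := [set w | (n.+1%:R^-1%:E <= `|X w - Y w|)%E].
have negF n : P.-negligible (F n).
  exists (F n); split=> //; first exact: measurable_abse_ge.
  apply/eqP; rewrite -measure_le0; apply/lee_addgt0Pr => eta eta_gt0.
  by rewrite add0e; apply/ltW/small.
have aeF : {ae P, forall w, ~ (\bigcup_n F n) w}.
  by apply: negligibleS (negligible_bigcup negF) => w /= /contrapT.
case: finX finY => _ finX [_ finY].
apply: filterS3 finX finY aeF => w /fineK Xw /fineK Yw nF.
rewrite -Xw -Yw; congr EFin; apply/eqP; rewrite -subr_eq0 -normr_le0 leNgt; apply/negP => gt0.
(* This index n satisfies 1 / (n + 1) <= |X - Y| at [w]. *)
apply: nF; exists (Num.truncn `|fine (X w) - fine (Y w)|^-1) => //; rewrite /F /=.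
by rewrite -Xw -Yw -EFinB /= lee_fin invf_ple ?posrE// ltW ?truncnS_gt.
Qed.

End AlmostEverywhere.

(** * Uniqueness of the integral in probability *)

Section IntegralInProbability.
Context {R : realType} {d : measure_display} {E : measurableType d}.
Variable P : probability E R.
Variables (a b : R) (f : R -> E -> \bar R).
Hypothesis finf : forall t, t \in `[a, b] -> ae_finite_rv P (f t).

Lemma ae_finite_rv_riemann_sum s tau : tagged_division a b s tau ->
  ae_finite_rv P (rv_riemann_sum a b f s tau).
Proof.
move=> div_s; apply: ae_finite_rv_sum => i; apply: ae_finite_rvZ.
exact/finf/(tagged_division_mem div_s).
Qed.

(** Both integrals are compared with one Riemann sum S, fine for both gauges: where |I - J| >= eps,
    a.e. one of |S - I|, |S - J| is at least eps / 2. *)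
Lemma is_KH_integral_prob_unique (I J : E -> \bar R) : a <= b ->
  is_KH_integral_prob P a b f I -> is_KH_integral_prob P a b f J ->
  {ae P, forall w, I w = J w}.
Proof.
move=> ab [finI intI] [finJ intJ]; apply: ae_eq_probability => // eps eta e0 h0.
have e2 : 0 < eps / 2 by rewrite divr_gt0.
have h2 : 0 < eta / 2 by rewrite divr_gt0.
have [dI dI0 {}intI] := intI _ _ e2 h2.
have [dJ dJ0 {}intJ] := intJ _ _ e2 h2.
have [|s [tau [div_s fine_s]]] :=
    @exists_gauge_fine R a b (fun t => Num.min (dI t) (dJ t)) ab.
  by move=> t tab; rewrite lt_min dI0 ?dJ0.
have finS := ae_finite_rv_riemann_sum div_s.
have fineI : gauge_fine a b dI s tau.
  by move=> i /fine_s; rewrite lt_min => /andP[].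
have fineJ : gauge_fine a b dJ s tau.
  by move=> i /fine_s; rewrite lt_min => /andP[].
have {}intI := intI s tau div_s fineI.
have {}intJ := intJ s tau div_s fineJ.
set S := rv_riemann_sum a b f s tau in finS intI intJ.
have [mIJ _] := ae_finite_rvB finI finJ.
have [mSI _] := ae_finite_rvB finS finI.
have [mSJ _] := ae_finite_rvB finS finJ.
have mAI := measurable_abse_ge (eps / 2) mSI.
have mAJ := measurable_abse_ge (eps / 2) mSJ.
rewrite [eta]splitr EFinD; apply: le_lt_trans (lteD intI intJ).
apply: le_trans (measureU2 _ mAI mAJ).
apply: le_measure_ae; [exact: measurable_abse_ge|exact: measurableU|].
case: finI finJ finS => _ finI [_ finJ] [_ finS].
apply: filterS3 finI finJ finS => w /= /fineK <- /fineK <- /fineK <-.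
rewrite -!EFinB /= !lee_fin => IJ.
apply/orP; rewrite -implyNb -ltNge; apply/implyP => SI.
move: IJ (ler_distD (fine (S w)) (fine (I w)) (fine (J w))).
by rewrite (distrC (fine (I w)) (fine (S w))); lra.
Qed.

End IntegralInProbability.

(** * Integration of linear combinations with random coefficients *)

Section LinearCombination.
Context {R : realType} {d : measure_display} {E : measurableType d}.
Variable P : probability E R.

Lemma riemann_sum_linear (a b : R) (p : nat) (c : 'I_p -> R)
    (phi : 'I_p -> R -> R) s tau :
  \sum_(k < p) c k * riemann_sum a b (phi k) s tau =
  riemann_sum a b (fun t => \sum_(k < p) c k * phi k t) s tau.
Proof.
rewrite /riemann_sum; under eq_bigr do rewrite mulr_sumr.
rewrite exchange_big; apply: eq_bigr => i _ /=.
by rewrite mulr_suml; apply: eq_bigr => k _; rewrite mulrA.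
Qed.

(* Off an event of probability at most eta, the weights satisfy
   sum_k |C_k| < M, so it suffices to approximate each integral within
   eps / M. *)
Lemma is_KH_integral_prob_linear (a b : R) (p : nat) (f : R -> E -> \bar R)
    (C : 'I_p -> E -> \bar R) (phi : 'I_p -> R -> R) (J : 'I_p -> R) :
  (forall t, t \in `[a, b] -> ae_finite_rv P (f t)) ->
  (forall k, ae_finite_rv P (C k)) ->
  (forall k, is_KH_integral a b (phi k) (J k)) ->
  (forall t, t \in `[a, b] ->
    {ae P, forall w, f t w = (\sum_(k < p) C k w * (phi k t)%:E)%E}) ->
  is_KH_integral_prob P a b f (fun w => (\sum_(k < p) C k w * (J k)%:E)%E).
Proof.
move=> finf finC intphi fE.
have finI : ae_finite_rv P (fun w => (\sum_(k < p) C k w * (J k)%:E)%E).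
  by apply: ae_finite_rv_sum => k; exact: ae_finite_rvZ.
split=> // eps eta eps_gt0 eta_gt0.
pose G w := (\sum_(k < p) `|C k w|)%E.
have finG : ae_finite_rv P G.
  by apply: ae_finite_rv_sum => k; exact: ae_finite_rv_abse.
have [M M_gt0 PG] := ae_finite_rv_tail finG eta_gt0.
have eM : 0 < eps / M by rewrite divr_gt0.
have /choice[delta deltaP] : forall k, exists dk, gauge_on a b dk /\
    forall s xi, tagged_division a b s xi -> gauge_fine a b dk s xi ->
      `|J k - riemann_sum a b (phi k) s xi| < eps / M.
  by move=> k; have [dk dk0 intk] := intphi k _ eM; exists dk.
(* A division fine for this minimum is fine for every [delta k]. *)
exists (fun t => \big[Num.min/1]_(k < p) delta k t).
  by move=> t tab; apply: lt_bigmin => // k _; apply: (deltaP k).1.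
move=> s tau div_s fine_s; apply: le_lt_trans PG.
have [mSI _] := ae_finite_rvB (ae_finite_rv_riemann_sum finf div_s) finI.
have [mG _] := finG.
apply: le_measure_ae; [exact: measurable_abse_ge|exact: measurable_abse_ge|].
have aeC : {ae P, forall w, forall k, C k w \is a fin_num}.
  by apply: filter_forall => k; case: (finC k).
(* The null set in [fE] depends on the point t; only finitely many tags occur, so one null set
   serves them all. *)
have aef : {ae P, forall w, forall i : 'I_(size s),
    f (tau i) w = (\sum_(k < p) C k w * (phi k (tau i))%:E)%E}.
  by apply: filter_forall => i; exact/fE/(tagged_division_mem div_s).
apply: filterS2 aeC aef => w Cw fw /=.
pose c k := fine (C k w).
have cE k : C k w = (c k)%:E by rewrite /c fineK.
have -> : rv_riemann_sum a b f s tau w =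
    (\sum_(k < p) c k * riemann_sum a b (phi k) s tau)%:E.
  rewrite riemann_sum_linear /riemann_sum -sumEFin; apply: eq_bigr => i _.
  rewrite fw EFinM -sumEFin; congr (_ * _)%E.
  by apply: eq_bigr => k _; rewrite cE.
have -> : (\sum_(k < p) C k w * (J k)%:E)%E = (\sum_(k < p) c k * J k)%:E.
  by rewrite -sumEFin; apply: eq_bigr => k _; rewrite cE.
have -> : G w = (\sum_(k < p) `|c k|)%:E.
  by rewrite -sumEFin; apply: eq_bigr => k _; rewrite cE.
rewrite -EFinB /= !lee_fin [X in _ -> _ <= X]ger0_norm ?sumr_ge0// => le_eps.
(* Multiplied by eps / M, the goal becomes eps <= (sum of the |c_k|) * (eps / M), which is proved
   termwise. *)
rewrite -(ler_pM2r eM) [M * _]mulrC divfK ?gt_eqF//.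
apply: (le_trans le_eps); rewrite -sumrB mulr_suml.
apply: (le_trans (ler_norm_sum _ _ _)); apply: ler_sum => k _.
rewrite -mulrBr normrM ler_wpM2l// distrC ltW//.
apply: (deltaP k).2 => // i /fine_s /lt_le_trans; apply.
exact: bigmin_le.
Qed.

End LinearCombination.

Unset Implicit Arguments.

Theorem theorem3p2 (R : realType) (d : measure_display) (E : measurableType d)
    (P : probability E R) (a b : R) (hab : a < b) (p : nat) (hp : (1 <= p)%N)
    (f : R -> E -> \bar R)
    (hf : forall t, t \in `[a, b] -> ae_finite_rv P (f t))
    (C : 'I_p -> E -> \bar R) (hC : forall k, ae_finite_rv P (C k))
    (phi : 'I_p -> R -> R) (hphi : forall k, KH_integrable a b (phi k))
    (hform : forall t, t \in `[a, b] ->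
      {ae P, forall w, f t w = (\sum_(k < p) C k w * (phi k t)%:E)%E}) :
  KH_integrable_prob P a b f /\
  {ae P, forall w, KH_integral_prob P a b f w =
    (\sum_(k < p) C k w * (KH_integral a b (phi k))%:E)%E}.
Proof.
(* Integrability makes [xget] return an actual integral instead of its default [0]. *)
have intphi k : is_KH_integral a b (phi k) (KH_integral a b (phi k)).
  exact: (xgetPex 0 (hphi k)).
have intf := is_KH_integral_prob_linear hf hC intphi hform.
have int_f : KH_integrable_prob P a b f by eexists; exact: intf.
split=> //; apply: (is_KH_integral_prob_unique hf (ltW hab) _ intf).
exact: (xgetPex (cst 0%E) int_f).
Qed.
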